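(* Let $b\in\{N,D\}$. Let $\mu$ be a non-atomic Borel probability measure on $[0,1]$ with $0,1\in\operatorname{supp}(\mu)$, and let $(\mu_n)_{n\in\mathbb{N}}$ be a sequence of non-atomic Borel probability measures on $[0,1]$ with $0,1\in\operatorname{supp}(\mu_n)$ and $\operatorname{supp}(\mu)\subseteq\operatorname{supp}(\mu_n)$ for all $n$, such that $\mu_n$ converges weakly to $\mu$ as $n\to\infty$. Then for every $f\in\mathcal{D}(\bar\Delta_\mu^b)$ there exists a sequence $(f_n)_{n\in\mathbb{N}}$ with $f_n\in\mathcal{D}(\bar\Delta_{\mu_n}^b)$ for every $n\in\mathbb{N}$ such that $$\lim_{n\to\infty}\Big(\left\lVert\pi_n f-f_n\right\rVert_\infty+\left\lVert\pi_n\bar\Delta_\mu^b f-\bar\Delta_{\mu_n}^b f_n\right\rVert_\infty\Big)=0.$$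
   Context: For a non-atomic Borel probability measure $\nu$ on $[0,1]$ with $0,1\in\operatorname{supp}(\nu)$: Let $\mathcal{D}_\nu^2$ be the set of $f\in C^1([0,1])$ for which there is $(f')^\nu\in L^2([0,1],\nu)$ with $f'(x)=f'(0)+\int_0^x (f')^\nu\,d\nu$ for all $x\in[0,1]$. The Krein-Feller operators $\Delta_\nu^N$ (Neumann) and $\Delta_\nu^D$ (Dirichlet) on $L^2([0,1],\nu)$ are given by $f\mapsto(f')^\nu$ (computed from the representative in $\mathcal{D}_\nu^2$), with domains: $\mathcal{D}(\Delta_\nu^N)$ is the set of $f\in L^2([0,1],\nu)$ having a representative $\bar f\in\mathcal{D}_\nu^2$ with $\bar f'(0)=\bar f'(1)=0$; $\mathcal{D}(\Delta_\nu^D)$ is the set of $f\in L^2([0,1],\nu)$ having a representative $\bar f\in\mathcal{D}_\nu^2$ with $\bar f(0)=\bar f(1)=0$. $(C[0,1])_\nu^N$ is the set of elements of $L^2([0,1],\nu)$ having a continuous representative on $[0,1]$; $(C[0,1])_\nu^D$ is the set of those having a continuous representative $\bar f$ with $\bar f(0)=\bar f(1)=0$. Each is a Banach space with norm $\lVert f\rVert_\infty:=\sup_{x\in\operatorname{supp}(\nu)}|\bar f(x)|$, $\bar f$ a continuous representative; equivalently, the sup norm over $[0,1]$ of the continuous representative that is linear on every interval contained in $[0,1]\setminus\operatorname{supp}(\nu)$. For $b\in\{N,D\}$, $\bar\Delta_\nu^b$ is the part of $\Delta_\nu^b$ in $(C[0,1])_\nu^b$: $\bar\Delta_\nu^b f=\Delta_\nu^b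 f$ with $\mathcal{D}(\bar\Delta_\nu^b)=\{f\in\mathcal{D}(\Delta_\nu^b):\Delta_\nu^b f\in(C[0,1])_\nu^b\}$. When $\operatorname{supp}(\mu)\subseteq\operatorname{supp}(\mu_n)$, the embedding $\pi_n:(C[0,1])_\mu^b\to(C[0,1])_{\mu_n}^b$ sends $f$ to the $L^2([0,1],\mu_n)$-equivalence class of the continuous representative of $f$ that is linear on every interval contained in $[0,1]\setminus\operatorname{supp}(\mu)$. *)

(* Defs.v *)
From HB Require Import structures.
From mathcomp Require Import all_boot all_order all_algebra.
From mathcomp Require Import all_classical all_reals all_analysis.
From mathcomp Require Import measurable_realfun.

Set Implicit Arguments.
Unset Strict Implicit.
Unset Printing Implicit Defensive.

Import Order.TTheory GRing.Theory Num.Theory.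
Import numFieldNormedType.Exports.

Local Open Scope classical_set_scope.
Local Open Scope ring_scope.

(* A Borel probability measure nu on [0,1] is encoded as a Borel probability
   measure on the line with nu [0,1] = 1; then L^2([0,1], nu) is the library
   space LspaceType2 nu.  Of a function R -> R that stands for a function on
   [0,1], only the values on [0,1] are ever used. *)

Section measures_on_the_unit_interval.
Context {R : realType}.

Definition is_atom (nu : probability R R) (A : set R) : Prop :=
  [/\ measurable A, (0 < nu A)%E &
    forall B : set R, measurable B -> B `<=` A -> nu B = 0%E \/ nu B = nu A].

Definition non_atomic (nu : probability R R) : Prop :=
  forall A : set R, ~ is_atom nu A.

(* As nu [0,1] = 1 and [0,1] is closed, this is also the support of nu as a
   measure on the space [0,1]. *)
Definition supp (nu : probability R R) : set R :=
  [set x | forall U : set R, open U -> U x -> (0 < nu U)%E].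

Definition admissible (nu : probability R R) : Prop :=
  [/\ nu `[0, 1]%classic = 1%E, non_atomic nu, supp nu 0 & supp nu 1].

(* The test functions are all of C([0,1]); they are automatically bounded. *)
Definition weakly_converges (nu_ : nat -> probability R R)
    (nu : probability R R) : Prop :=
  forall h : R -> R, {within `[0, 1], continuous h} ->
    (\int[nu_ n]_(x in `[0, 1]) h x)%R @[n --> \oo]
      --> (\int[nu]_(x in `[0, 1]) h x)%R.

End measures_on_the_unit_interval.

HB.instance Definition _ (R : realType) (nu : probability R R) :=
  gen_eqMixin (LspaceType nu (lee1n 2)).
HB.instance Definition _ (R : realType) (nu : probability R R) :=
  gen_choiceMixin (LspaceType nu (lee1n 2)).

Section L2_classes.
Context {R : realType}.
Variable nu : probability R R.
Notation L2fun := (LfunType nu (lee1n 2)).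

(* The library types the elements of LspaceType with the codomain
   measurableTypeR R, which carries the same sigma-algebra as R. *)
Lemma L2fun_measurable (f : L2fun) :
  @measurable_fun _ _ R (measurableTypeR R) setT f.
Proof. exact: (@measurable_funPT _ _ R R f). Qed.

Definition mfun_of_L2fun (f : L2fun) : {mfun R >-> measurableTypeR R} :=
  HB.pack (f : R -> measurableTypeR R)
    (@isMeasurableFun.Build _ _ R (measurableTypeR R) f (L2fun_measurable f)).

Definition ae_class (f : L2fun) : {mfun_ nu, R >-> measurableTypeR R} :=
  (\pi_({mfun_ nu, R >-> measurableTypeR R}) (mfun_of_L2fun f))%qT.

Lemma ae_classE (f : L2fun) : ae_class f = f %[ae nu].
Proof.
have : (repr (ae_class f) == mfun_of_L2fun f
          %[mod {mfun_ nu, R >-> measurableTypeR R}])%qT by rewrite reprK.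
by rewrite eqmodE => /asboolP.
Qed.

Lemma ae_class_finite_norm (f : L2fun) : finite_norm nu 2%:E (ae_class f).
Proof.
have := @Lfunction_finite _ _ _ _ _ (lee1n 2) f.
rewrite /finite_norm unlock.
suff -> : (\int[nu]_x (`|(EFin \o ae_class f) x| `^ 2)
           = \int[nu]_x (`|(EFin \o f) x| `^ 2))%E by [].
apply: ge0_ae_eq_integral => //.
- apply: (measurableT_comp (measurable_poweR _)).
  apply: measurableT_comp => //; apply/measurable_EFinP.
  exact: (@measurable_funPT _ _ R (measurableTypeR R) (repr (ae_class f))).
- apply: (measurableT_comp (measurable_poweR _)).
  apply: measurableT_comp => //; apply/measurable_EFinP.
  exact: (@measurable_funPT _ _ R R f).
- by move=> x _; exact: poweR_ge0.
- by move=> x _; exact: poweR_ge0.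
- by apply: filterS (ae_classE f) => x /(_ I) fx _ /=; rewrite fx.
Qed.

Definition L2class_of (f : L2fun) : LspaceType2 nu :=
  HB.pack (ae_class f)
    (@isFinLebesgue.Build _ R R nu 2%:E (lee1n 2) (ae_class f)
      (ae_class_finite_norm f)).

(* The class of a square-integrable Borel function (the class of 0 for any
   other function). *)
Definition L2class (f : R -> R) : LspaceType2 nu :=
  L2class_of (insubd (0 : L2fun) f).

Lemma L2classE (f : R -> R) : f \in Lfun nu 2%:E -> L2class f = f %[ae nu].
Proof.
move=> fL; have fE : insubd (0 : L2fun) f = f :> (R -> R) := insubdK _ fL.
by apply: filterS (ae_classE (insubd (0 : L2fun) f)) => x /[apply] ->; rewrite fE.
Qed.

Lemma L2_ext (f g : LspaceType2 nu) : f = g %[ae nu] -> f = g.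
Proof.
case: f => f [[pf]]; case: g => g [[pg]] fg.
have e : f = g by rewrite -[f]reprK -[g]reprK; apply/eqmodP; exact/asboolP.
by move: pf pg {fg}; rewrite e => pf pg; rewrite (Prop_irrelevance pf pg).
Qed.

Definition L2sub (f g : LspaceType2 nu) : LspaceType2 nu :=
  L2class (fun x : R => (f x : R) - (g x : R)).

End L2_classes.

Variant boundary := Neumann | Dirichlet.

Section Krein_Feller.
Context {R : realType}.
Implicit Types nu mu : probability R R.

Definition represents nu (fbar : R -> R) (f : LspaceType2 nu) : Prop :=
  \forall x \ae nu, x \in `[0, 1] -> f x = fbar x :> R.

Definition continuous_rep nu (f : LspaceType2 nu) : set (R -> R) :=
  [set fbar : R -> R | {within `[0, 1], continuous fbar} /\ represents fbar f].

(* The derivatives at 0 and 1 are one-sided. *)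
Definition C1_unit (f f' : R -> R) : Prop :=
  (forall x : R, x \in `[0, 1] ->
     (f y - f x) / (y - x) @[y --> within `[0, 1] x^'] --> f' x) /\
  {within `[0, 1], continuous f'}.

(* f' is the derivative of f and h is the density (f')^nu. *)
Definition in_D2 nu (f f' : R -> R) (h : LspaceType2 nu) : Prop :=
  C1_unit f f' /\
  forall x : R, x \in `[0, 1] ->
    f' x = f' 0 + (\int[nu]_(y in `[0, x]) (h y : R))%R.

Definition KF_boundary (b : boundary) (f f' : R -> R) : Prop :=
  match b with
  | Neumann => f' 0 = 0 /\ f' 1 = 0
  | Dirichlet => f 0 = 0 /\ f 1 = 0
  end.

Definition KF_graph b nu (f g : LspaceType2 nu) : Prop :=
  exists fbar f' : R -> R,
    [/\ represents fbar f, in_D2 fbar f' g & KF_boundary b fbar f'].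

Definition KF_dom b nu : set (LspaceType2 nu) :=
  [set f | exists g, KF_graph b f g].

(* The value outside of KF_dom b nu is irrelevant. *)
Definition KF b nu (f : LspaceType2 nu) : LspaceType2 nu :=
  xget f [set g | KF_graph b f g].

Definition Cspace b nu : set (LspaceType2 nu) :=
  [set f | exists2 fbar, continuous_rep f fbar &
     match b with
     | Neumann => True
     | Dirichlet => fbar 0 = 0 /\ fbar 1 = 0
     end].

(* Two continuous representatives coincide on the support. *)
Definition Cnorm nu (f : LspaceType2 nu) : R :=
  sup [set `|xget (fun=> 0) (continuous_rep f) x| | x in supp nu].

(* The part of KF b nu in Cspace b nu has the same values as KF b nu, so only
   its domain needs a definition. *)
Definition KF_part_dom b nu : set (LspaceType2 nu) :=
  [set f | KF_dom b f /\ Cspace b (KF b f)].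

Definition linear_on_gaps nu (fbar : R -> R) : Prop :=
  forall I : interval R, [set` I] `<=` `[0, 1] `\` supp nu ->
    exists c d : R, forall x, x \in I -> fbar x = c * x + d.

Definition gap_linear_rep mu (f : LspaceType2 mu) : R -> R :=
  xget (fun=> 0) [set fbar : R -> R | continuous_rep f fbar /\ linear_on_gaps mu fbar].

Definition embed mu nu (f : LspaceType2 mu) : LspaceType2 nu :=
  L2class nu (gap_linear_rep f \_ `[0, 1]).

End Krein_Feller.

Arguments KF_dom {R} b nu.
Arguments KF_part_dom {R} b nu.
Arguments Cspace {R} b nu.
Arguments embed {R mu} nu f.

(* Main.v *)
Require Import Defs.
From HB Require Import structures.
From mathcomp Require Import all_boot all_order all_algebra.
From mathcomp Require Import all_classical all_reals all_analysis.
From mathcomp Require Import measurable_realfun ring lra.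

Set Implicit Arguments.
Unset Strict Implicit.
Unset Printing Implicit Defensive.

Import Order.TTheory GRing.Theory Num.Theory.
Import numFieldNormedType.Exports.

Local Open Scope classical_set_scope.
Local Open Scope ring_scope.

(** Integrating f'' = g against a measure nu twice gives, for a continuous
    density g, the representation
      F x = F 0 + F' 0 * x + potential nu g x,
      potential nu g x = int_[0,x] (x - t) g(t) dnu(t)
                       = int_[0,1] max(x - t, 0) g(t) dnu(t),
    in which the measure enters only through integrals of continuous functions.
    Let F be the C^1 representative of f and G the gap-linear representative of
    the image of f.  The approximating element is obtained by keeping the density
    and replacing mu by mu_n:
      F_n x = F 0 + a_n * x + potential mu_n (G - m_n) x,
    where the constants restore the boundary conditions: a_n = 0 and
    m_n = int_[0,1] G dmu_n in the Neumann case, m_n = 0 and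
    a_n = - potential mu_n G 1 in the Dirichlet case.

    The operator for mu_n maps the class of F_n to the class of G - m_n, so the
    second norm is at most |m_n|, which tends to 0 since int G dmu = F' 1 - F' 0
    vanishes in the Neumann case.  For the first norm, weak convergence gives
    potential mu_n G x --> potential mu G x for each x, and the Lipschitz bound
    |G| <= M, common to all these potentials, makes the convergence uniform
    ([potential_cvg]).

    Two facts make the objects in the statement well defined.  A function of
    D2 is affine on each gap of the support, because its derivative is constant
    there ([in_D2_linear_on_gaps]), and a continuous gap-linear function is
    determined by its values on the support ([linear_on_gaps_ext]).  Hence F is
    the gap-linear representative of f, and the graph of the operator is
    single-valued ([KF_graph_unique]): F determines F', thus the integral of the
    density over each [0,x], thus the density almost everywhere.  Conversely
    each continuous function can be made gap-linear without changing it on the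
    support ([gap_interp_continuous]). *)

(** * Calculus on the closed unit interval *)

Section unit_interval_calculus.
Context {R : realType}.
Implicit Types (f g : R -> R) (a b c d e k l x y M : R).

Lemma within01_continuousP f :
  {within `[0, 1], continuous f} <->
  forall x, 0 <= x <= 1 -> forall e, 0 < e ->
    exists2 d : R, 0 < d &
      forall y, 0 <= y <= 1 -> `|y - x| < d -> `|f y - f x| < e.
Proof.
rewrite subspace_continuousP; split => [fc x x01 e e0|fc x /= x01].
  have /fc/cvgrPdist_lt/(_ e e0) : `[0, 1]%classic x by rewrite /= in_itv.
  rewrite near_withinE near_simpl => /nbhs_ballP[d /= d0 dP]; exists d => // y y01 yx.
  rewrite distrC; apply: dP; last exact: y01.
  by rewrite /ball /= distrC.
apply/cvgrPdist_lt => e e0; rewrite in_itv /= in x01.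
have [d d0 dP] := fc _ x01 _ e0.
rewrite near_withinE near_simpl; apply/nbhs_ballP; exists d => //= y yx /=.
by rewrite in_itv /= => y01; rewrite distrC; apply: dP => //; rewrite distrC.
Qed.

Lemma diff_quotient01P f x l :
  ((f y - f x) / (y - x) @[y --> within `[0, 1] x^'] --> l) <->
  forall e, 0 < e -> exists2 d : R, 0 < d &
    forall y, 0 <= y <= 1 -> y != x -> `|y - x| < d ->
      `|(f y - f x) / (y - x) - l| < e.
Proof.
split => [/cvgrPdist_lt fl e e0|fl].
  have := fl e e0; rewrite !near_withinE near_simpl.
  move=> /nbhs_ballP[d /= d0 dP]; exists d => // y y01 yx yxd.
  rewrite distrC; apply: dP => //.
  by rewrite /ball /= distrC.
apply/cvgrPdist_lt => e e0; have [d d0 dP] := fl _ e0.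
rewrite !near_withinE near_simpl; apply/nbhs_ballP; exists d => //= y yxd yx.
by rewrite in_itv /= => y01; rewrite distrC; apply: dP => //; rewrite distrC.
Qed.

Lemma C1_unit_cvg f f' x : C1_unit f f' -> 0 <= x <= 1 ->
  forall e, 0 < e -> exists2 d : R, 0 < d &
    forall y, 0 <= y <= 1 -> y != x -> `|y - x| < d ->
      `|(f y - f x) / (y - x) - f' x| < e.
Proof. by move=> [/(_ x)ff' _] x01; apply/diff_quotient01P/ff'; rewrite in_itv. Qed.

Lemma C1_unit_continuous f f' : C1_unit f f' -> {within `[0, 1], continuous f}.
Proof.
move=> ff'; apply/within01_continuousP => x x01 e e0.
have [d d0 dP] := C1_unit_cvg ff' x01 ltr01.
exists (Num.min d (e / (`|f' x| + 1))).
  by rewrite lt_min d0 divr_gt0// ltr_wpDl.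
move=> y y01; rewrite lt_min => /andP[yd].
rewrite ltr_pdivlMr ?ltr_wpDl// => ye.
have [->|yx] := eqVneq y x; first by rewrite subrr normr0.
have := dP y y01 yx yd => h.
have yx0 : 0 < `|y - x| by rewrite normr_gt0 subr_eq0.
have -> : f y - f x = (f y - f x) / (y - x) * (y - x).
  by rewrite divfK// subr_eq0.
rewrite normrM mulrC; apply: le_lt_trans ye; rewrite ler_pM2l//.
have -> : (f y - f x) / (y - x) = (f y - f x) / (y - x) - f' x + f' x by ring.
by rewrite (le_trans (ler_normD _ _))// addrC lerD2l ltW.
Qed.

(** At an interior point the one-sided notion is the usual derivative. *)
Lemma C1_unit_is_derive f f' x : C1_unit f f' -> 0 < x < 1 ->
  is_derive x 1 f (f' x).
Proof.
move=> ff' /andP[x0 x1].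
have fl : h^-1 *: (f (h *: 1 + x) - f x) @[h --> (0:R)^'] --> f' x.
  apply/cvgrPdist_lt => e e0.
  have x01 : 0 <= x <= 1 by rewrite !ltW.
  have [d d0 dP] := C1_unit_cvg ff' x01 e0.
  rewrite near_withinE; apply/nbhs_ballP.
  exists (Num.min d (Num.min x (1 - x))); first by rewrite /= !lt_min d0 x0 subr_gt0.
  move=> h; rewrite /ball /= sub0r normrN !lt_min => /and3P[hd hx hx1] h0.
  have -> : h^-1 *: (f (h *: 1 + x) - f x) = (f (h + x) - f x) / (h + x - x).
    by rewrite [h *: 1]mulr1 addrK [RHS]mulrC.
  rewrite distrC; apply: dP; last by rewrite addrK.
    by move: hx hx1; rewrite !ltr_norml => /andP[? ?] /andP[? ?]; apply/andP; split; lra.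
  by rewrite -subr_eq0 addrK.
by split; [apply/cvg_ex; exists (f' x)|apply: cvg_lim].
Qed.

(** Mean value theorem: only the derivative inside the interval matters, so
    that [a] and [b] may be end points of a gap or of [0,1]. *)
Lemma C1_unit_slope f f' a b c : C1_unit f f' -> 0 <= a -> a <= b -> b <= 1 ->
  (forall x, a < x < b -> f' x = c) -> f b - f a = c * (b - a).
Proof.
move=> ff' a0 ab b1 f'c; move: ab; rewrite le_eqVlt => /predU1P[->|ab].
  by rewrite !subrr mulr0.
have [x| |z zab ->] := @MVT _ f f' _ _ ab.
- rewrite in_itv /= => /andP[ax xb]; apply: (C1_unit_is_derive ff').
  by rewrite (le_lt_trans a0)//= (lt_le_trans xb).
- apply: continuous_subspaceW (C1_unit_continuous ff').
  by apply: subset_itv; rewrite bnd_simp.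
by rewrite f'c//; rewrite in_itv in zab.
Qed.

(** The punctured neighbourhoods of a point of [0,1] meet [0,1]. *)
Lemma unit_interval_perfect x d : 0 <= x <= 1 -> 0 < d ->
  exists y, [/\ 0 <= y <= 1, y != x & `|y - x| < d].
Proof.
move=> /andP[x0 x1] d0; have [xh|xh] := leP x (2^-1).
  exists (x + Num.min (d / 2) (2^-1)).
  have m0 : 0 < Num.min (d / 2) (2^-1 : R) by rewrite lt_min; apply/andP; split; lra.
  have m1 : Num.min (d / 2) (2^-1 : R) <= 2^-1 by rewrite ge_min lexx orbT.
  have m2 : Num.min (d / 2) (2^-1 : R) <= d / 2 by rewrite ge_min lexx.
  split; first (apply/andP; split; lra).
    by rewrite -subr_eq0 addrC addKr gt_eqF.
  by rewrite addrC addKr gtr0_norm//; lra.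
exists (x - Num.min (d / 2) (2^-1)).
have m0 : 0 < Num.min (d / 2) (2^-1 : R) by rewrite lt_min; apply/andP; split; lra.
have m1 : Num.min (d / 2) (2^-1 : R) <= 2^-1 by rewrite ge_min lexx orbT.
have m2 : Num.min (d / 2) (2^-1 : R) <= d / 2 by rewrite ge_min lexx.
split; first (apply/andP; split; lra).
  by rewrite -subr_eq0 addrC addKr oppr_eq0 gt_eqF.
by rewrite addrC addKr normrN gtr0_norm//; lra.
Qed.

Lemma C1_unit_deriv_unique f f' g g' : C1_unit f f' -> C1_unit g g' ->
  (forall x, 0 <= x <= 1 -> f x = g x) ->
  forall x, 0 <= x <= 1 -> f' x = g' x.
Proof.
move=> ff' gg' fg x x01; apply/eqP; rewrite -subr_eq0 -normr_le0.
apply/ler_addgt0Pr => e e0; rewrite add0r.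
have e20 : 0 < e / 2 by lra.
have [d1 d10 d1P] := C1_unit_cvg ff' x01 e20.
have [d2 d20 d2P] := C1_unit_cvg gg' x01 e20.
have d0 : 0 < Num.min d1 d2 by rewrite lt_min d10.
have [y [y01 yx]] := unit_interval_perfect x01 d0.
rewrite lt_min => /andP[/(d1P _ y01 yx) h1 /(d2P _ y01 yx)].
rewrite -fg// -fg// => h2.
have -> : f' x - g' x = ((f y - f x) / (y - x) - g' x) - ((f y - f x) / (y - x) - f' x).
  by ring.
by rewrite (le_trans (ler_normB _ _))//; lra.
Qed.

Lemma within01_bounded f : {within `[0, 1], continuous f} ->
  exists2 M : R, 0 <= M & forall x, 0 <= x <= 1 -> `|f x| <= M.
Proof.
move=> fc.
have fnc : {within `[0, 1], continuous (fun x => `|f x|)}.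
  by move=> x; apply: continuous_comp; [exact: fc|exact: norm_continuous].
have [z _ zM] := EVT_max (@ler01 R) fnc.
by exists `|f z| => // x x01; apply: zM; rewrite in_itv.
Qed.

Lemma C1_unit_affine a c : C1_unit (fun x => c + a * x) (fun=> a).
Proof.
split; last by move=> x; exact: cst_continuous.
move=> x _; apply/diff_quotient01P => e e0; exists 1 => // y _ yx _.
suff -> : (c + a * y - (c + a * x)) / (y - x) - a = 0 by rewrite normr0.
by field; rewrite subr_eq0.
Qed.

Lemma C1_unit_lincomb f f' g g' k : C1_unit f f' -> C1_unit g g' ->
  C1_unit (fun x => f x + k * g x) (fun x => f' x + k * g' x).
Proof.
move=> [ff' f'c] [gg' g'c]; split.
  move=> x x01 /=; set q := (X in X @ _ --> _).
  have -> : q = (fun y => (f y - f x) / (y - x) + k * ((g y - g x) / (y - x))).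
    by apply/funext => y; rewrite /q; ring.
  exact: (cvgD (ff' _ x01) (cvgM (cvg_cst k) (gg' _ x01))).
by move=> x; exact: (cvgD (f'c x) (cvgM (cvg_cst k) (g'c x))).
Qed.

End unit_interval_calculus.

(** * The support of a measure *)

Section support.
Context {R : realType}.
Variable nu : probability R R.
Implicit Types (x y a b e d : R).

Lemma non_atomic_set1 x : non_atomic nu -> nu [set x] = 0%E.
Proof.
move=> nua; apply/eqP; rewrite eq_le measure_ge0 andbT leNgt; apply/negP => x0.
apply: (nua [set x]); split => // B _ /subset_set1[->|->]; last by right.
by left; exact: measure0.
Qed.

(** Continuity from above along the intervals that shrink to [x]. *)
Lemma non_atomic_small x e : non_atomic nu -> 0 < e ->
  exists2 d : R, 0 < d & (nu `[(x - d)%R, (x + d)%R]%classic <= e%:E)%E.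
Proof.
move=> nua e0.
pose F n : set R := `[x - n.+1%:R^-1, x + n.+1%:R^-1]%classic.
have capF : \bigcap_n F n = [set x].
  apply/seteqP; split => [y Fy|y ->{y} n _]; last first.
    by rewrite /F /= in_itv /= gerBl lerDl invr_ge0 ler0n.
  apply/eqP; rewrite /= -subr_eq0 -normr_le0.
  apply/ler_addgt0Pr => d d0; rewrite add0r.
  have [n nd] : exists n : nat, n.+1%:R^-1 < d.
    by have [n _ /(_ n (leqnn n))] := near_infty_natSinv_lt (PosNum d0); exists n.
  have := Fy n I; rewrite /F /= in_itv /=; move: (n.+1%:R^-1) nd => i nd /andP[h1 h2].
  by rewrite ler_norml; apply/andP; split; lra.
have : (nu \o F) n @[n --> \oo] --> nu (\bigcap_n F n).
  apply: nonincreasing_cvg_mu => //.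
  - by rewrite ltey_eq fin_num_measure//; exact: measurable_itv.
  - by move=> n; exact: measurable_itv.
  - by rewrite capF; exact: measurable_set1.
  - move=> m n mn; apply/subsetPset => y; rewrite /F /= !in_itv /=.
    have : n.+1%:R^-1 <= m.+1%:R^-1 :> R.
      by rewrite lef_pV2 ?posrE ?ltr0n// ler_nat.
    move: (n.+1%:R^-1 : R) (m.+1%:R^-1 : R) => i j.
    by move=> ? /andP[? ?]; apply/andP; split; lra.
rewrite capF non_atomic_set1// => /fine_cvgP[_ /cvgrPdist_lt /(_ _ e0)[n _ /(_ n (leqnn n))]].
rewrite /= sub0r normrN => h; exists n.+1%:R^-1; first by rewrite invr_gt0.
rewrite -[leLHS]fineK ?lee_fin; last exact: fin_num_measure.
by apply: le_trans (ltW h); exact: ler_norm.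
Qed.

Lemma not_supp_null x : ~ supp nu x ->
  exists2 e : R, 0 < e & nu `](x - e)%R, (x + e)%R[%classic = 0%E.
Proof.
move=> /existsNP[U /not_implyP[oU /not_implyP[Ux /negP]]].
rewrite -leNgt => U0; have /nbhs_ballP[e /= e0 eU] := open_nbhs_nbhs (conj oU Ux).
exists e => //; apply/eqP; rewrite eq_le measure_ge0 andbT.
apply: le_trans U0; apply: le_measure; rewrite ?inE//; first exact: open_measurable.
by apply: subset_trans eU => y; rewrite ball_itv.
Qed.

(** The support is closed. *)
Lemma supp_adherent x :
  (forall e, 0 < e -> exists2 s : R, supp nu s & `|s - x| < e) -> supp nu x.
Proof.
move=> h; apply: contrapT => /not_supp_null[e e0 n0].
have [s ss sx] := h e e0.
suff : (0 < nu `](x - e)%R, (x + e)%R[%classic)%E by rewrite n0 ltxx.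
apply: ss; first exact: interval_open.
by move: sx; rewrite /= in_itv/= ltr_norml => /andP[? ?]; apply/andP; split; lra.
Qed.

(** The complement of the support is covered by the countably many null
    intervals with rational end points. *)
Lemma negligible_setC_supp : nu.-negligible (~` supp nu).
Proof.
pose J (q : rat * rat) : set R := `](ratr q.1 : R), (ratr q.2 : R)[%classic.
(* the null intervals among the [J q], enumerated along the rational pairs *)
pose F n := if @unpickle (rat * rat)%type n is Some q then
  if nu (J q) == 0%E then J q else set0 else set0.
apply: (@negligibleS _ _ _ _ (\bigcup_n F n)); last first.
  apply: negligible_bigcup => n; rewrite /F; case: unpickle => [q|]; last exact: negligible_set0.
  case: ifPn => [/eqP q0|_]; last exact: negligible_set0.
  by apply/negligibleP => //; exact: measurable_itv.
move=> x /not_supp_null[e e0 n0].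
have /rat_in_itvoo[p] : x - e < x by lra.
rewrite in_itv /= => /andP[p1 p2].
have /rat_in_itvoo[q] : x < x + e by lra.
rewrite in_itv /= => /andP[q1 q2].
have n1 : nu (J (p, q)) == 0%E.
  rewrite eq_le measure_ge0 andbT -n0; apply: le_measure; rewrite ?inE.
  - exact: measurable_itv.
  - exact: measurable_itv.
  - by apply: subset_itv; rewrite bnd_simp ltW.
have FJ : F (pickle (p, q)) = J (p, q) by rewrite /F pickleK n1.
exists (pickle (p, q)); first by [].
by rewrite FJ /J /= in_itv /= p2.
Qed.

Lemma gap_null (A : set R) : measurable A -> A `<=` ~` supp nu -> nu A = 0%E.
Proof.
by move=> mA AS; apply/negligibleP => //; exact: negligibleS negligible_setC_supp.
Qed.

Hypothesis nuA : admissible nu.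

Lemma negligible_setC_itv01 : nu.-negligible (~` `[0, 1]%classic).
Proof.
apply/negligibleP; first by apply: measurableC; exact: measurable_itv.
transitivity (1 - nu `[0%R, 1%R]%classic)%E.
  by apply: probability_setC; exact: measurable_itv.
by case: nuA => -> _ _ _; rewrite subee.
Qed.

Lemma supp_sub01 x : supp nu x -> 0 <= x <= 1.
Proof.
move=> sx; suff : `[0, 1]%classic x by rewrite /= in_itv.
apply: contrapT => x01; have := sx (~` `[0, 1]%classic).
have -> : nu (~` `[0, 1]%classic) = 0%E.
  apply/negligibleP; last exact: negligible_setC_itv01.
  by apply: measurableC; exact: measurable_itv.
rewrite ltxx => /(_ _ x01); suff o : open (~` `[(0:R), 1]%classic) by move/(_ o).
by apply: closed_openC; exact: interval_closed.
Qed.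

(** Where two continuous functions differ at a point of the support, they
    differ on a neighbourhood of it, which has positive measure. *)
Lemma continuous_ae_eq_supp (f g : R -> R) :
  {within `[0, 1], continuous f} -> {within `[0, 1], continuous g} ->
  (\forall x \ae nu, x \in `[0, 1] -> f x = g x) ->
  forall x, supp nu x -> f x = g x.
Proof.
move=> /within01_continuousP fc /within01_continuousP gc fg x sx.
have x01 := supp_sub01 sx.
apply/eqP; rewrite -subr_eq0; apply: contrapT => /negP; rewrite -normr_gt0 => fgx.
have e0 : 0 < `|f x - g x| / 2 by lra.
have [d1 d10 d1P] := fc _ x01 _ e0.
have [d2 d20 d2P] := gc _ x01 _ e0.
pose d := Num.min d1 d2.
have d0 : 0 < d by rewrite lt_min d10.
suff : nu `](x - d)%R, (x + d)%R[%classic = 0%E.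
  move=> n0; suff : (0 < nu `](x - d)%R, (x + d)%R[%classic)%E by rewrite n0 ltxx.
  by apply: sx; [exact: interval_open|rewrite /= in_itv /= ltrBlDr ltrDl d0].
apply/negligibleP; first exact: measurable_itv.
apply: negligibleS (negligibleU fg negligible_setC_itv01).
move=> y; rewrite /= in_itv /= => /andP[y1 y2].
have [y01|] := boolP (y \in `[0, 1]); last by move=> /negP; right.
left => /(_ isT) fgy.
have yd : `|y - x| < d by rewrite ltr_norml; apply/andP; split; lra.
move: yd y01; rewrite lt_min in_itv /= => /andP[yd1 yd2] y01.
have h1 := d1P _ y01 yd1; have h2 := d2P _ y01 yd2.
suff : `|f x - g x| < `|f x - g x| by rewrite ltxx.
have {1}-> : f x - g x = (g y - g x) - (f y - f x) by rewrite fgy; ring.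
by rewrite (le_lt_trans (ler_normB _ _))//; lra.
Qed.

End support.

(** * Gap-linear functions *)

Section gap_interpolation.
Context {R : realType}.
Variable nu : probability R R.
Hypothesis nuA : admissible nu.
Implicit Types (x y a b c d e : R) (f g : R -> R).

Let supp0 : supp nu 0. Proof. by case: nuA. Qed.
Let supp1 : supp nu 1. Proof. by case: nuA. Qed.

(** The points of the support nearest to [x] from the left and from the right:
    both are [x] on the support, and the ends of the gap around [x] elsewhere. *)
Definition left_end x := sup [set s | supp nu s /\ s <= x].
Definition right_end x := inf [set s | supp nu s /\ x <= s].

Lemma left_endP x : 0 <= x <= 1 ->
  [/\ supp nu (left_end x), left_end x <= x &
      forall s, supp nu s -> s <= x -> s <= left_end x].
Proof.
move=> /andP[x0 x1]; set A := [set s | supp nu s /\ s <= x].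
have A0 : A !=set0 by exists 0.
have ubA : ubound A x by move=> s [].
have sA : has_sup A by split => //; exists x.
split.
- apply: supp_adherent => e e0; have [s [ss sx] es] := sup_adherent e0 sA.
  exists s => //; have : s <= sup A by apply: ub_le_sup => //; exists x.
  by rewrite /left_end -/A ltr_norml => ?; apply/andP; split; lra.
- exact: ge_sup.
- by move=> s ss sx; apply: ub_le_sup; [exists x|split].
Qed.

Lemma right_endP x : 0 <= x <= 1 ->
  [/\ supp nu (right_end x), x <= right_end x &
      forall s, supp nu s -> x <= s -> right_end x <= s].
Proof.
move=> /andP[x0 x1]; set A := [set s | supp nu s /\ x <= s].
have A0 : A !=set0 by exists 1.
have lbA : lbound A x by move=> s [].
have sA : has_inf A by split => //; exists x.
split.
- apply: supp_adherent => e e0; have [s [ss sx] es] := inf_adherent e0 sA.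
  exists s => //; have : inf A <= s by apply: ge_inf => //; exists x.
  by rewrite /right_end -/A ltr_norml => ?; apply/andP; split; lra.
- exact: lb_le_inf.
- by move=> s ss sx; apply: ge_inf; [exists x|split].
Qed.

(** The open interval between the two ends is a gap; it is empty when [x] is in
    the support. *)
Lemma gap_subset x : 0 <= x <= 1 ->
  `]left_end x, right_end x[%classic `<=` `[0, 1] `\` supp nu.
Proof.
move=> x01 y; have [sl lx lP] := left_endP x01; have [sr xr rP] := right_endP x01.
rewrite /= in_itv /= => /andP[ly yr]; split.
  have /andP[l0 _] := supp_sub01 nuA sl; have /andP[_ r1] := supp_sub01 nuA sr.
  by rewrite in_itv /=; apply/andP; split; lra.
move=> sy; have [yx|/ltW xy] := leP y x.
  by have := lP _ sy yx; rewrite leNgt ly.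
by have := rP _ sy xy; rewrite leNgt yr.
Qed.

Lemma affine_endpoints f a b c d : a < b -> {within `[a, b], continuous f} ->
  (forall x, a < x < b -> f x = c * x + d) ->
  f a = c * a + d /\ f b = c * b + d.
Proof.
move=> ab /(continuous_within_itvP f ab)[_ fa fb] fE.
have lin x : {for x, continuous (fun y : R => c * y + d)}.
  by apply: continuousD; [exact: mulrl_continuous|exact: cst_continuous].
split.
  apply: (cvg_unique (@norm_hausdorff R R) fa).
  apply: cvg_trans (cvg_at_right_filter (lin a)).
  apply: near_eq_cvg; near=> y; rewrite fE//; apply/andP; split.
    by near: y; exact: nbhs_right_gt.
  by near: y; exact: nbhs_right_lt.
apply: (cvg_unique (@norm_hausdorff R R) fb).
apply: cvg_trans (cvg_at_left_filter (lin b)).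
apply: near_eq_cvg; near=> y; rewrite fE//; apply/andP; split.
  by near: y; exact: nbhs_left_gt.
by near: y; exact: nbhs_left_lt.
Unshelve. all: by end_near. Qed.

(** On a gap, a continuous gap-linear function is the linear interpolation of
    its values at the ends. *)
Lemma linear_on_gaps_affine f x :
  {within `[0, 1], continuous f} -> linear_on_gaps nu f ->
  0 <= x <= 1 -> ~ supp nu x ->
  f x = f (left_end x) + (x - left_end x) / (right_end x - left_end x) *
          (f (right_end x) - f (left_end x)).
Proof.
move=> fc fl x01 sx; have [sl lx lP] := left_endP x01; have [sr xr rP] := right_endP x01.
have lx' : left_end x < x.
  by rewrite lt_neqAle lx andbT; apply/eqP => e; apply: sx; rewrite -e.
have xr' : x < right_end x.
  by rewrite lt_neqAle xr andbT; apply/eqP => e; apply: sx; rewrite e.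
have [c [d cd]] := fl _ (@gap_subset _ x01).
have fcd y : left_end x < y < right_end x -> f y = c * y + d.
  by move=> h; apply: cd; rewrite in_itv.
have [|-> ->] := affine_endpoints (lt_trans lx' xr') _ fcd.
  apply: continuous_subspaceW fc; apply: subset_itv; rewrite bnd_simp.
    by have /andP[] := supp_sub01 nuA sl.
  by have /andP[] := supp_sub01 nuA sr.
rewrite fcd ?lx'//; field.
by rewrite subr_eq0 gt_eqF// (lt_trans lx').
Qed.

Lemma linear_on_gaps_ext f g :
  {within `[0, 1], continuous f} -> linear_on_gaps nu f ->
  {within `[0, 1], continuous g} -> linear_on_gaps nu g ->
  (forall x, supp nu x -> f x = g x) ->
  forall x, 0 <= x <= 1 -> f x = g x.
Proof.
move=> fc fl gc gl fg x x01.
have [|sx] := pselect (supp nu x); first exact: fg.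
have [sl _ _] := left_endP x01; have [sr _ _] := right_endP x01.
by rewrite (linear_on_gaps_affine fc)// (linear_on_gaps_affine gc)// !fg.
Qed.

(** The function that agrees with [g] on the support of [nu] and is affine on
    its gaps.  On the support the quotient is 0 / 0 = 0, so the same formula
    returns [g x] there. *)
Definition gap_interp g x := g (left_end x) +
  (x - left_end x) / (right_end x - left_end x) * (g (right_end x) - g (left_end x)).

Lemma gap_interp_supp g x : supp nu x -> gap_interp g x = g x.
Proof.
move=> sx; have x01 := supp_sub01 nuA sx.
have [sl lx lP] := left_endP x01; have [sr xr rP] := right_endP x01.
have l : left_end x = x by apply/eqP; rewrite eq_le lx lP.
by rewrite /gap_interp l subrr !mul0r addr0.
Qed.

(** All the points of an interval that misses the support have the same ends. *)
Lemma gap_interp_linear g : linear_on_gaps nu (gap_interp g).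
Proof.
move=> I IS; have [[x0 Ix0]|I0] := pselect (exists x, x \in I); last first.
  by exists 0, 0 => x Ix; exfalso; apply: I0; exists x.
have convI : is_interval [set` I] by exact: interval_is_interval.
have I01 x : x \in I -> 0 <= x <= 1.
  by move=> /IS[] /=; rewrite in_itv.
have le_ends x y : x \in I -> y \in I -> x <= y ->
    left_end x = left_end y /\ right_end x = right_end y.
  move=> Ix Iy xy.
  have [slx lx lPx] := left_endP (I01 _ Ix); have [srx xr rPx] := right_endP (I01 _ Ix).
  have [sly ly lPy] := left_endP (I01 _ Iy); have [sry yr rPy] := right_endP (I01 _ Iy).
  have out z : x <= z <= y -> ~ supp nu z.
    by move=> xzy; have /IS[] : [set` I] z by exact: (convI x y).
  split; apply/eqP; rewrite eq_le.
    rewrite lPy//=; last exact: le_trans xy.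
    by apply: lPx => //; rewrite leNgt; apply/negP => /ltW h; apply: (out (left_end y)); rewrite // h.
  rewrite rPx//=; last exact: le_trans yr.
  by apply: rPy => //; rewrite leNgt; apply/negP => /ltW h; apply: (out (right_end x)); rewrite // h andbT.
set l := left_end x0; set r := right_end x0.
exists ((g r - g l) / (r - l)), (g l - l / (r - l) * (g r - g l)) => x Ix.
rewrite /gap_interp; have [-> ->] : left_end x = l /\ right_end x = r.
  have [xx0|/ltW x0x] := leP x x0; first exact: le_ends.
  by have [h1 h2] := le_ends _ _ Ix0 Ix x0x; split.
by ring.
Qed.

(** A convex combination of [p] and [q] is near [z] when [p] is, provided that
    [q] is near [z] too or that the weight [u] of [q] is small. *)
Let interp_estimate (u p q z M e : R) : 0 <= u <= 1 -> 0 < e -> 0 <= M ->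
  `|p| <= M -> `|q| <= M -> `|p - z| < e / 2 ->
  `|q - z| < e / 2 \/ u * (4 * (M + 1)) <= e ->
  `|p + u * (q - p) - z| < e.
Proof.
move=> /andP[u0 u1] e0 M0 pM qM pz [qz|ue].
  have -> : p + u * (q - p) - z = (1 - u) * (p - z) + u * (q - z) by ring.
  rewrite (le_lt_trans (ler_normD _ _))// !normrM (ger0_norm u0) ger0_norm; last lra.
  have h1 : (1 - u) * `|p - z| <= (1 - u) * (e / 2) by apply: ler_wpM2l; [lra|exact: ltW].
  have h2 : u * `|q - z| <= u * (e / 2) by rewrite ler_wpM2l// ltW.
  lra.
have -> : p + u * (q - p) - z = (p - z) + u * (q - p) by ring.
rewrite (le_lt_trans (ler_normD _ _))// normrM (ger0_norm u0).
have h : u * `|q - p| <= u * (2 * M).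
  by rewrite ler_wpM2l// (le_trans (ler_normB _ _))//; lra.
lra.
Qed.

(** The delicate points are those of the support.  For [y] near such an [x], the
    end of the gap of [y] on the side of [x] is between [x] and [y].  The other
    end is either near [x], or at distance at least [d] from [x], in which case
    its weight in the interpolation is at most [`|y - x| / d]. *)
Lemma gap_interp_continuous g :
  {within `[0, 1], continuous g} -> {within `[0, 1], continuous (gap_interp g)}.
Proof.
move=> gc; have [M M0 gM] := within01_bounded gc.
move/within01_continuousP in gc; apply/within01_continuousP => x x01 e e0.
(* off the support, [gap_interp g] is affine around [x] *)
have [sx|sx] := pselect (supp nu x); last first.
  have [sl lx lP] := left_endP x01; have [sr xr rP] := right_endP x01.
  have lx' : left_end x < x.
    by rewrite lt_neqAle lx andbT; apply/eqP => h; apply: sx; rewrite -h.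
  have xr' : x < right_end x.
    by rewrite lt_neqAle xr andbT; apply/eqP => h; apply: sx; rewrite h.
  have [c [d cd]] := gap_interp_linear g (@gap_subset _ x01).
  exists (Num.min (e / (`|c| + 1)) (Num.min (x - left_end x) (right_end x - x))).
    by rewrite !lt_min; apply/and3P; split; [rewrite divr_gt0// ltr_wpDl|lra|lra].
  move=> y y01; rewrite !lt_min => /and3P[ye].
  move=> /ltr_normlP[y1 _] /ltr_normlP[_ y2].
  have -> : gap_interp g y = c * y + d by apply: cd; rewrite in_itv /=; apply/andP; split; lra.
  have -> : gap_interp g x = c * x + d by apply: cd; rewrite in_itv /= lx'.
  have -> : c * y + d - (c * x + d) = c * (y - x) by ring.
  rewrite normrM; rewrite ltr_pdivlMr ?ltr_wpDl// in ye.
  by apply: le_lt_trans ye; rewrite mulrC ler_wpM2l// lerDl.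
rewrite gap_interp_supp//.
have [d d0 dP] := gc x x01 (e / 2) (divr_gt0 e0 (ltr0Sn _ 1)).
have M4 : 0 < 4 * (M + 1) by lra.
exists (Num.min d (d * e / (4 * (M + 1)))).
  by rewrite lt_min d0 divr_gt0// mulr_gt0.
move=> y y01; rewrite lt_min ltr_pdivlMr// => /andP[yd ye].
have [sl ly lP] := left_endP y01; have [sr yr rP] := right_endP y01.
have l01 := supp_sub01 nuA sl; have r01 := supp_sub01 nuA sr.
rewrite /gap_interp; set l := left_end y in sl ly lP l01 *.
set r := right_end y in sr yr rP r01 *.
have [lr|lr] := eqVneq l r.
  have -> : l = y by apply/eqP; rewrite eq_le ly lr yr.
  by rewrite subrr !mul0r addr0; apply: lt_trans (dP _ y01 yd) _; lra.
have lr0 : 0 < r - l by rewrite subr_gt0 lt_neqAle lr (le_trans ly).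
have t01 : 0 <= (y - l) / (r - l) <= 1.
  by rewrite divr_ge0 ?subr_ge0 ?(le_trans ly)//= ler_pdivrMr// mul1r lerD2r.
have [xy|/ltW yx] := leP x y.
  have xl : x <= l by exact: lP.
  rewrite (ger0_norm _) ?subr_ge0// in yd ye.
  apply: (@interp_estimate _ _ _ _ M) => //; [exact: gM|exact: gM| |].
    by apply: dP => //; rewrite ger0_norm ?subr_ge0//; lra.
  have [rd|rd] := ltP (r - x) d.
    by left; apply: dP => //; rewrite ger0_norm//; lra.
  right; rewrite mulrAC ler_pdivrMr// -(ler_pM2r d0).
  have h1 : (y - l) * d <= (y - l) * (r - x) by rewrite ler_wpM2l// subr_ge0.
  have h2 : 0 <= (l - x) * (r - y) by rewrite mulr_ge0 ?subr_ge0.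
  have h3 : (y - l) * d * (4 * (M + 1)) <= (y - x) * (r - l) * (4 * (M + 1)).
    by rewrite ler_pM2r//; lra.
  have h4 : (y - x) * (4 * (M + 1)) * (r - l) <= d * e * (r - l).
    by rewrite ler_pM2r// ltW.
  lra.
have rx : r <= x by exact: rP.
rewrite (ler0_norm _) ?subr_le0// opprB in yd ye.
have -> : g l + (y - l) / (r - l) * (g r - g l) =
          g r + (1 - (y - l) / (r - l)) * (g l - g r) by ring.
apply: (@interp_estimate _ _ _ _ M) => //; [lra|exact: gM|exact: gM| |].
  by apply: dP => //; rewrite ler0_norm ?subr_le0// opprB; lra.
have [ld|ld] := ltP (x - l) d.
  by left; apply: dP => //; rewrite ler0_norm ?subr_le0 ?opprB//; lra.
right; have -> : 1 - (y - l) / (r - l) = (r - y) / (r - l) by field; rewrite gt_eqF.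
rewrite mulrAC ler_pdivrMr// -(ler_pM2r d0).
have h1 : (r - y) * d <= (r - y) * (x - l) by rewrite ler_wpM2l// subr_ge0.
have h2 : 0 <= (x - r) * (y - l) by rewrite mulr_ge0 ?subr_ge0.
have h3 : (r - y) * d * (4 * (M + 1)) <= (x - y) * (r - l) * (4 * (M + 1)).
  by rewrite ler_pM2r//; lra.
have h4 : (x - y) * (4 * (M + 1)) * (r - l) <= d * e * (r - l).
  by rewrite ler_pM2r// ltW.
lra.
Qed.

End gap_interpolation.

(** * Square-integrable classes and their continuous representatives *)

Section square_integrable_classes.
Context {R : realType}.
Variable nu : probability R R.
Local Notation I01 := `[(0 : R), (1 : R)]%classic.
Implicit Types (f g : R -> R) (h u v : LspaceType2 nu) (x y : R).

Lemma Lspace_Lfun h : (fun x => h x : R) \in Lfun nu 2%:E.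
Proof.
rewrite inE; apply/andP; split; rewrite inE /=.
  exact: (@measurable_funPT _ _ R (measurableTypeR R) (repr (h : {mfun_ nu, R >-> measurableTypeR R}))).
exact: (@Lebesgue_finite _ _ _ _ _ _ h).
Qed.

Lemma Lspace_integrable h (A : set R) : measurable A ->
  nu.-integrable A (EFin \o (fun x => h x : R)).
Proof.
move=> mA; apply: (@integrableS _ _ _ _ setT) => //.
apply/Lfun1_integrable; apply: Lfun_subset12; last exact: Lspace_Lfun.
by apply: fin_num_measure.
Qed.

Lemma within01_measurable f : {within `[0, 1], continuous f} ->
  measurable_fun I01 f.
Proof. by move=> fc; apply: subspace_continuous_measurable_fun. Qed.

Lemma within01_integrable f (A : set R) : {within `[0, 1], continuous f} ->
  measurable A -> A `<=` I01 -> nu.-integrable A (EFin \o f).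
Proof.
move=> fc mA A01; apply: measurable_bounded_integrable => //.
- by rewrite ltey_eq fin_num_measure.
- by apply: measurable_funS A01 _ => //; exact: (within01_measurable fc).
- have [M M0 fM] := within01_bounded fc.
  exists M; split; first exact: num_real.
  by move=> N MN x /A01; rewrite /= in_itv /= => x01; rewrite (le_trans (fM _ x01))// ltW.
Qed.

Lemma patch_Lfun f : {within `[0, 1], continuous f} ->
  f \_ I01 \in Lfun nu 2%:E.
Proof.
move=> fc; have [M M0 fM] := within01_bounded fc.
have mf : measurable_fun setT (f \_ I01).
  apply/(measurable_restrictT f); first exact: measurable_itv.
  exact (within01_measurable fc).
rewrite inE; apply/andP; split; rewrite inE//=.
rewrite /finite_norm unlock poweR_lty//.
apply: (@le_lt_trans _ _ (\int[nu]_x (cst ((M `^ 2)%:E) x))%E); last first.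
  by rewrite integral_cst// ltey_eq fin_numM//; by apply: fin_num_measure.
apply: ge0_le_integral => //.
- by move=> x _; rewrite poweR_ge0.
- apply: (measurableT_comp (measurable_poweR _)).
  by apply: measurableT_comp => //; apply/measurable_EFinP.
- move=> x _ /=; rewrite lee_fin ge0_ler_powR// ?nnegrE//.
  rewrite patchE; case: ifPn => [|_]; last by rewrite normr0.
  by rewrite inE /= in_itv /= => /fM.
Qed.

Lemma continuous_rep_L2class f : {within `[0, 1], continuous f} ->
  continuous_rep (L2class nu (f \_ I01)) f.
Proof.
move=> fc; split=> //; apply: filterS (L2classE (patch_Lfun fc)) => x /(_ I) fx x01.
by rewrite fx patchE mem_set.
Qed.

Lemma continuous_rep_L2sub u v f g : continuous_rep u f -> continuous_rep v g ->
  continuous_rep (L2sub u v) (fun x => f x - g x).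
Proof.
move=> [fc fu] [gc gv]; split.
  by move=> x; apply: continuousB; [exact: fc|exact: gc].
have uv : (fun x => (u x : R) - (v x : R)) \in Lfun nu 2%:E.
  have [_ addL] := @Lfun_addr_closed _ _ R nu 2%:E (lee1n 2).
  have oppL := @Lfun_oppr_closed _ _ R nu 2%:E.
  exact: (addL _ _ (Lspace_Lfun u) (oppL _ (Lspace_Lfun v))).
move: fu gv (L2classE uv); apply: filterS3 => x fx gx uvx x01.
by rewrite uvx// fx// gx.
Qed.

Lemma Rintegral_continuous_rep u f (A : set R) : continuous_rep u f ->
  measurable A -> A `<=` I01 ->
  \int[nu]_(x in A) (u x : R) = \int[nu]_(x in A) f x.
Proof.
move=> [fc fu] mA A01; congr fine; apply: ae_eq_integral => //.
- by have /integrableP[] := Lspace_integrable u mA.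
- by have /integrableP[] := within01_integrable fc mA A01.
- by apply: filterS fu => x fx /A01 x01; rewrite fx.
Qed.

Section admissible_measure.
Hypothesis nuA : admissible nu.

Lemma represents_supp_eq u f g : {within `[0, 1], continuous f} ->
  {within `[0, 1], continuous g} -> represents f u -> represents g u ->
  forall x, supp nu x -> f x = g x.
Proof.
move=> fc gc fu gu; apply: continuous_ae_eq_supp => //.
by move: fu gu; apply: filterS2 => x fx gx x01; rewrite -fx// gx.
Qed.

(** The norm may be bounded through any continuous representative, since they
    all coincide on the support; it is nonnegative because the support is not
    empty. *)
Lemma Cnorm_le u f B : continuous_rep u f ->
  (forall x, 0 <= x <= 1 -> `|f x| <= B) -> 0 <= Cnorm u <= B.
Proof.
move=> uf fB; have s0 : supp nu 0 by case: nuA.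
have [gc gu] : continuous_rep u (xget (fun=> 0) (continuous_rep u)).
  by apply: xgetPex; exists f.
set g := xget _ _ in gc gu.
have gB x : supp nu x -> `|g x| <= B.
  case: uf => fc fu sx; rewrite (represents_supp_eq gc fc gu fu sx); apply: fB.
  exact: supp_sub01 sx.
apply/andP; split; last first.
  by apply: ge_sup; [exists `|g 0|, 0|move=> _ [x sx <-]; exact: gB].
apply: (@le_trans _ _ `|g 0|) => //; apply: ub_le_sup; last by exists 0.
by exists B => _ [x sx <-]; exact: gB.
Qed.

(** An element with a continuous representative also has a gap-linear one. *)
Lemma gap_linear_repP u f : continuous_rep u f ->
  continuous_rep u (gap_linear_rep u) /\ linear_on_gaps nu (gap_linear_rep u).
Proof.
move=> [fc fu].
suff : exists g, continuous_rep u g /\ linear_on_gaps nu g by exact: xgetPex.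
exists (gap_interp nu f); split; last exact: gap_interp_linear.
split; first exact: gap_interp_continuous.
have ns : \forall x \ae nu, supp nu x := negligible_setC_supp nu.
move: fu ns; apply: filterS2 => x fx sx x01.
by rewrite gap_interp_supp ?fx.
Qed.

End admissible_measure.

End square_integrable_classes.

(** * The Krein-Feller operator is single-valued *)

Section krein_feller_operator.
Context {R : realType}.
Variable nu : probability R R.
Local Notation I01 := `[(0 : R), (1 : R)]%classic.
Implicit Types (h u v : LspaceType2 nu) (x y : R).

Lemma Rintegral_itv_split (f : R -> R) x y : nu.-integrable I01 (EFin \o f) ->
  0 <= x -> x <= y -> y <= 1 ->
  \int[nu]_(t in `[0, y]) f t =
  \int[nu]_(t in `[0, x]) f t + \int[nu]_(t in `]x, y]) f t.
Proof.
move=> fi x0 xy y1.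
have -> : `[0, y]%classic = `[0, x]%classic `|` `]x, y]%classic :> set R.
  apply/seteqP; split => z /=; rewrite !in_itv /=.
    by move=> /andP[z0 zy]; have [zx|xz] := leP z x; [left|right]; rewrite ?z0.
  by case=> /andP[? ?]; apply/andP; split; lra.
apply: Rintegral_setU => //.
- apply: integrableS fi => //; first by apply: measurableU; exact: measurable_itv.
  move=> z [|]; rewrite /= !in_itv /= => /andP[? ?]; apply/andP; split; lra.
- apply/disj_setPS => z [] /=; rewrite !in_itv /= => /andP[? zx] /andP[xz ?]; lra.
Qed.

(** The increments of the derivative are integrals of the density, which
    vanish over subintervals of a gap. *)
Lemma in_D2_linear_on_gaps (f f' : R -> R) h : in_D2 f f' h -> linear_on_gaps nu f.
Proof.
move=> [ff' f'E] I IS.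
have [[x0 Ix0]|I0] := pselect (exists x, x \in I); last first.
  by exists 0, 0 => x Ix; exfalso; apply: I0; exists x.
have convI : is_interval [set` I] by exact: interval_is_interval.
have I01' x : x \in I -> 0 <= x <= 1 by move=> /IS[] /=; rewrite in_itv.
have f'c x y : x \in I -> y \in I -> x <= y -> f' y = f' x.
  move=> Ix Iy xy; have /andP[x0' x1] := I01' _ Ix; have /andP[y0 y1] := I01' _ Iy.
  rewrite f'E ?in_itv/= ?y0// [RHS]f'E ?in_itv/= ?x0'//.
  have hi : nu.-integrable I01 (EFin \o (fun x => h x : R)) by exact: Lspace_integrable.
  rewrite (Rintegral_itv_split hi x0' xy y1) /Rintegral.
  rewrite [X in _ + (_ + fine X)]null_set_integral ?addr0//.
    apply: measurable_funS (measurable_int _ hi) => //.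
    by apply: subset_itv; rewrite bnd_simp.
  apply: gap_null => // z; rewrite /= in_itv /= => /andP[xz zy] sz.
  have /IS[] // : [set` I] z.
  by apply: (convI x y) => //; rewrite (ltW xz).
have fslope x y : x \in I -> y \in I -> x <= y -> f y - f x = f' x * (y - x).
  move=> Ix Iy xy; have /andP[x0' x1] := I01' _ Ix; have /andP[y0 y1] := I01' _ Iy.
  apply: (C1_unit_slope ff') => // z /andP[/ltW xz /ltW zy]; apply: f'c => //.
  by apply: (convI x y) => //; rewrite xz.
exists (f' x0), (f x0 - f' x0 * x0) => x Ix.
have [xx0|/ltW x0x] := leP x x0.
  by have := fslope _ _ Ix Ix0 xx0; rewrite (f'c _ _ Ix Ix0 xx0) => ?; lra.
by have := fslope _ _ Ix0 Ix x0x => ?; lra.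
Qed.

(** The sets [A] such that the integral over [A] in [0,1] vanishes form a Dynkin
    system that contains the rays, hence all Borel sets. *)
Lemma integral_itv_eq0_ae (g : R -> \bar R) : nu.-integrable setT g ->
  (forall x, 0 <= x <= 1 -> (\int[nu]_(t in `[0%R, x]) g t = 0)%E) ->
  ae_eq nu I01 g (cst 0%E).
Proof.
move=> gi g0; apply: integral_ae_eq => //.
  exact: integrableS gi.
have gS A : measurable A -> nu.-integrable A g by move=> mA; exact: integrableS gi.
have split01 A : measurable A ->
    (\int[nu]_(t in I01) g t = \int[nu]_(t in A `&` I01) g t +
                               \int[nu]_(t in ~` A `&` I01) g t)%E.
  move=> mA; have mAI : measurable (A `&` I01) by exact: measurableI.
  have mAI' : measurable (~` A `&` I01) by apply: measurableI => //; exact: measurableC.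
  rewrite -integral_setU//.
  - by rewrite -setIUl setUv setTI.
  - by have /measurable_int := gS _ (measurableU _ _ mAI mAI').
  - by apply/disj_setPS => z [[Az _] [nAz _]]; exact: nAz.
have I0 : (\int[nu]_(t in I01) g t = 0)%E by apply: g0; rewrite ler01 lexx.
have sub0 A : measurable A -> (\int[nu]_(t in A `&` I01) g t = 0 ->
    \int[nu]_(t in ~` A `&` I01) g t = 0)%E.
  by move=> mA A0; have := split01 _ mA; rewrite I0 A0 add0e => <-.
have ray0 x : (\int[nu]_(t in `]-oo, x] `&` I01) g t = 0)%E.
  have [x0|x0] := ltP x 0.
    rewrite (_ : _ `&` _ = set0) ?integral_set0//.
    apply/seteqP; split; last exact: sub0set.
    move=> z [] /=; rewrite !in_itv /= => zx /andP[z0 _].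
    by have := le_lt_trans (le_trans z0 zx) x0; rewrite ltxx.
  have [x1|x1] := leP x 1.
    rewrite (_ : _ `&` _ = `[0, x]%classic) ?g0 ?x0//.
    apply/seteqP; split => z /=; rewrite !in_itv /=; first by move=> [-> /andP[-> _]].
    by move=> /andP[z0 zx]; split => //; rewrite z0 (le_trans zx).
  rewrite (_ : _ `&` _ = I01)//; apply/seteqP; split => z /=; first by case.
  by rewrite !in_itv /= => /andP[z0 z1]; split; rewrite ?z0// (le_trans z1)// ltW.
have all0 (A : set R) : measurable A -> (\int[nu]_(t in A `&` I01) g t = 0)%E.
  move=> mA; pose P (B : set R) := (\int[nu]_(t in B `&` I01) g t = 0)%E.
  have mE : @measurable _ R = <<s @RGenOInfty.G R >> by exact: RGenOInfty.measurableE.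
  apply: (@dynkin_induction _ R (@RGenOInfty.G R) P) => //.
  - move=> _ _ [x ->] [y ->]; exists (Num.max x y).
    by apply/seteqP; split => z /=; rewrite !in_itv /= !andbT gt_max; [move=> [-> ->]|move=> /andP].
  - by rewrite /P setTI.
  - move=> _ [x ->]; rewrite /P -setCitvl; exact: sub0.
  - move=> F mF tF F0; have mFI k : measurable (F k `&` I01) by exact: measurableI.
    rewrite /P setI_bigcupl integral_bigcup//; first by rewrite eseries0// => k _ _; exact: F0.
      by move=> i j _ _ [z [[Fi _] [Fj _]]]; apply: tF => //; exists z.
    by apply: gS; exact: bigcupT_measurable.
  - by rewrite -mE.
by move=> E E01 mE; have := all0 _ mE; rewrite (setIidl E01) => ->; rewrite integral0.
Qed.

Hypothesis nuA : admissible nu.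
Variable b : boundary.

(** The representatives of [f] in D2 agree on the support and are affine on the
    gaps, so they are equal, and so are their derivatives. *)
Lemma KF_graph_unique (f u v : LspaceType2 nu) : KF_graph b f u -> KF_graph b f v -> u = v.
Proof.
move=> [F1 [F1' [F1f D1 _]]] [F2 [F2' [F2f D2 _]]].
have F1c := C1_unit_continuous D1.1; have F2c := C1_unit_continuous D2.1.
have F12 : forall x, 0 <= x <= 1 -> F1 x = F2 x.
  apply: (linear_on_gaps_ext nuA) => //.
  - exact: in_D2_linear_on_gaps D1.
  - exact: in_D2_linear_on_gaps D2.
  - exact: (represents_supp_eq nuA F1c F2c F1f F2f).
have F12' := C1_unit_deriv_unique D1.1 D2.1 F12.
have uvi (A : set R) : measurable A -> nu.-integrable A (fun x => ((u x : R) - (v x : R))%:E).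
  by move=> mA; exact: (integrableB mA (Lspace_integrable u mA) (Lspace_integrable v mA)).
have : ae_eq nu I01 (fun x => ((u x : R) - (v x : R))%:E) (cst 0%E).
  apply: integral_itv_eq0_ae; first exact: uvi.
  move=> x x01; have mx : measurable (`[0, x]%classic : set R) by exact: measurable_itv.
  rewrite -[LHS]fineK ?(integrable_fin_num mx (uvi _ mx))//; congr EFin.
  rewrite [LHS]RintegralB//; [|exact: Lspace_integrable|exact: Lspace_integrable].
  have := D1.2 x; rewrite in_itv /= => /(_ x01).
  have := D2.2 x; rewrite in_itv /= => /(_ x01).
  by rewrite !F12' ?lexx ?ler01// => -> /addrI ->; rewrite subrr.
move=> uv; apply: L2_ext.
have n01 : \forall x \ae nu, I01 x := negligible_setC_itv01 nuA.
move: uv n01; apply: filterS2 => x uvx x01 _.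
by have [/eqP] := uvx x01; rewrite subr_eq0 => /eqP.
Qed.

Lemma KF_graph_KF (f : LspaceType2 nu) : KF_dom b nu f -> KF_graph b f (KF b f).
Proof. by move=> [g fg]; apply: (@xgetPex _ f [set g | KF_graph b f g]); exists g. Qed.

Lemma KF_graph_eq (f g : LspaceType2 nu) : KF_graph b f g -> KF b f = g.
Proof. by move=> fg; apply: (KF_graph_unique (KF_graph_KF _) fg); exists g. Qed.

End krein_feller_operator.

(** * Sequences of equi-Lipschitz functions *)

Section equi_lipschitz.
Context {R : realType}.
Implicit Types (e x y M : R).

(** Pointwise convergence of equi-Lipschitz functions is uniform on [0,1]: it is
    enough to control the finitely many points [i / k.+1] of a fine grid. *)
Lemma equi_lipschitz_cvg (u_ : nat -> R -> R) (u : R -> R) M : 0 <= M ->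
  (forall n x y, 0 <= x <= 1 -> 0 <= y <= 1 -> `|u_ n x - u_ n y| <= M * `|x - y|) ->
  (forall x y, 0 <= x <= 1 -> 0 <= y <= 1 -> `|u x - u y| <= M * `|x - y|) ->
  (forall x, 0 <= x <= 1 -> u_ n x @[n --> \oo] --> u x) ->
  forall e, 0 < e ->
    \forall n \near \oo, forall x, 0 <= x <= 1 -> `|u_ n x - u x| <= e.
Proof.
move=> M0 u_L uL u_u e e0.
have e4 : 0 < e / (4 * (M + 1)) by rewrite divr_gt0// mulr_gt0//; lra.
have [k ke] : exists k : nat, k.+1%:R^-1 < e / (4 * (M + 1)).
  by have [k _ /(_ k (leqnn k))] := near_infty_natSinv_lt (PosNum e4); exists k.
have k0 : 0 < k.+1%:R :> R by rewrite ltr0n.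
pose p (i : 'I_k.+2) : R := i%:R / k.+1%:R.
have p01 i : 0 <= p i <= 1.
  by rewrite /p divr_ge0//= ler_pdivrMr// mul1r ler_nat -ltnS.
have : \forall n \near \oo, forall i : 'I_k.+2, `|u_ n (p i) - u (p i)| < e / 2.
  apply: filter_forall => i; have /cvgrPdist_lt := u_u _ (p01 i).
  have e20 : 0 < e / 2 by lra.
  by move=> /(_ _ e20); apply: filterS => n; rewrite distrC.
apply: filterS => n un x /andP[x0 x1].
have xk0 : 0 <= x * k.+1%:R by rewrite mulr_ge0// ltW.
(* [x] is compared with the grid point just below it *)
have /andP[t1 t2] := truncn_itv xk0.
have tk : (Num.truncn (x * k.+1%:R) < k.+2)%N.
  rewrite ltnS -(ler_nat R) (le_trans t1)// ler_piMl// ltW//.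
pose i := Ordinal tk.
have xp : `|x - p i| <= k.+1%:R^-1.
  rewrite /p /= ger0_norm; last by rewrite subr_ge0 ler_pdivrMr.
  by rewrite lerBlDr addrC -[X in _ + X]mul1r -mulrDl ler_pdivlMr// natr1 ltW.
have h1 := u_L n x (p i); have h2 := uL (p i) x.
rewrite x0 x1 p01 in h1 h2; have {}h1 := h1 isT isT; have {}h2 := h2 isT isT.
have h3 := un i.
have Mx : M * `|x - p i| <= e / 4.
  rewrite (le_trans (ler_wpM2l M0 xp))//.
  have : M * k.+1%:R^-1 <= (M + 1) * (e / (4 * (M + 1))).
    by apply: ler_pM => //; [lra|exact: ltW].
  by move=> /le_trans; apply; rewrite le_eqVlt; apply/orP; left; apply/eqP; field; lra.
rewrite [`|p i - x|]distrC in h2.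
have -> : u_ n x - u x = (u_ n x - u_ n (p i)) + (u_ n (p i) - u (p i)) + (u (p i) - u x).
  by ring.
rewrite (le_trans (ler_normD _ _))//.
have h4 := ler_normD (u_ n x - u_ n (p i)) (u_ n (p i) - u (p i)).
lra.
Qed.

End equi_lipschitz.

(** * The potential of a continuous density *)

Section potential.
Context {R : realType}.
Local Notation I01 := `[(0 : R), (1 : R)]%classic.
Implicit Types (nu : probability R R) (G : R -> R) (a b c e k m x y t M : R).

(** The solution of u'' = G, with respect to [nu], such that u 0 = u' 0 = 0. *)
Definition potential nu G x := \int[nu]_(t in `[0, x]) ((x - t) * G t).

Lemma normr_Rintegral_le nu (A : set R) (f : R -> R) B : measurable A ->
  nu.-integrable A (EFin \o f) -> (forall x, A x -> `|f x| <= B) ->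
  `|\int[nu]_(x in A) f x| <= B * fine (nu A).
Proof.
move=> mA fi fB; rewrite (le_trans (le_normr_Rintegral mA fi))//.
rewrite -Rintegral_cst//; apply: le_Rintegral => //.
  exact: integrable_norm.
by apply: finite_measure_integrable_cst.
Qed.

Lemma within01_integrand G x : {within `[0, 1], continuous G} ->
  {within `[0, 1], continuous (fun t => (x - t) * G t)}.
Proof.
move=> Gc t; have lin : {within `[0, 1], continuous (fun t : R => x - t)}.
  apply: continuous_subspaceT => s; apply: continuousB; last exact: id.
  exact: cst_continuous.
exact: (cvgM (lin t) (Gc t)).
Qed.

Lemma within01_max_integrand G x : {within `[0, 1], continuous G} ->
  {within `[0, 1], continuous (fun t => Num.max (x - t) 0 * G t)}.
Proof.
move=> Gc t; have lin : {within `[0, 1], continuous (fun t : R => Num.max (x - t) 0)}.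
  apply: continuous_subspaceT => s.
  have xc : {for s, continuous (fun t : R => x - t : R^o)}.
    by apply: continuousB; [exact: cst_continuous|exact: id].
  have c0 : {for s, continuous (fun t : R => 0 : R^o)} by exact: cst_continuous.
  exact: (continuous_max xc c0).
exact: (cvgM (lin t) (Gc t)).
Qed.

(** The potential integrates a continuous test function over all of [0,1], so
    that weak convergence applies to it. *)
Lemma potentialE nu G x : {within `[0, 1], continuous G} -> 0 <= x <= 1 ->
  potential nu G x = \int[nu]_(t in I01) (Num.max (x - t) 0 * G t).
Proof.
move=> Gc /andP[x0 x1].
have mi := within01_integrable nu (within01_max_integrand (x:=x) Gc) (measurable_itv _) (@subset_refl _ I01).
rewrite (Rintegral_itv_split mi x0 x1 (lexx 1)).
rewrite [X in _ = _ + X](_ : _ = 0) ?addr0.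
  apply: eq_Rintegral => t; rewrite inE /= in_itv /= => /andP[_ tx].
  by rewrite max_l// subr_ge0.
rewrite (eq_Rintegral _ (g := fun=> 0)) ?Rintegral_cst ?mul0r// => t.
rewrite inE /= in_itv /= => /andP[xt _].
by rewrite max_r ?mul0r// subr_le0 ltW.
Qed.

(** First-order expansion at the left end [a]: the remainder is the integral of
    [(b - t) * G t] over ]a, b]. *)
Lemma potential_increment nu G a b M : {within `[0, 1], continuous G} ->
  (forall x, 0 <= x <= 1 -> `|G x| <= M) -> 0 <= M -> 0 <= a -> a <= b -> b <= 1 ->
  `|potential nu G b - potential nu G a - (b - a) * \int[nu]_(t in `[0, a]) G t|
    <= M * (b - a) * fine (nu `]a, b]%classic).
Proof.
move=> Gc GM M0 a0 ab b1.
have sub01 (A : set R) (f : R -> R) : measurable A -> A `<=` I01 ->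
    {within `[0, 1], continuous f} -> nu.-integrable A (EFin \o f).
  by move=> mA A01 fc; exact: within01_integrable.
have s0a : `[0, a]%classic `<=` I01 by apply: subset_itv; rewrite bnd_simp// (le_trans ab).
have sab : `]a, b]%classic `<=` I01 by apply: subset_itv; rewrite bnd_simp.
have m0a : measurable (`[0, a]%classic : set R) by exact: measurable_itv.
have mab : measurable (`]a, b]%classic : set R) by exact: measurable_itv.
have bi := sub01 _ _ (measurable_itv `[0, 1]) (@subset_refl _ I01) (within01_integrand (x:=b) Gc).
rewrite /potential (Rintegral_itv_split bi a0 ab b1).
have -> : \int[nu]_(t in `[0, a]) ((b - t) * G t) =
    \int[nu]_(t in `[0, a]) ((a - t) * G t) + (b - a) * \int[nu]_(t in `[0, a]) G t.
  rewrite -RintegralZl//; last exact: sub01.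
  rewrite -RintegralD//.
  - by apply: eq_Rintegral => t _; ring.
  - by apply: sub01 => //; exact: within01_integrand.
  - by apply: sub01 => //; move=> t; exact: (cvgM (cvg_cst (b - a)) (Gc t)).
rewrite [X in `|X|](_ : _ = \int[nu]_(t in `]a, b]) ((b - t) * G t)); last by ring.
apply: normr_Rintegral_le => //.
  by apply: sub01 => //; exact: within01_integrand.
move=> t; rewrite /= in_itv /= => /andP[at_ tb].
rewrite normrM mulrC (ger0_norm (x := b - t)) ?subr_ge0//; apply: ler_pM => //; [lra| |lra].
  by apply: GM; apply/andP; split; lra.
Qed.

Lemma Rintegral_increment nu G a b M : {within `[0, 1], continuous G} ->
  (forall x, 0 <= x <= 1 -> `|G x| <= M) -> 0 <= a -> a <= b -> b <= 1 ->
  `|\int[nu]_(t in `[0, b]) G t - \int[nu]_(t in `[0, a]) G t|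
    <= M * fine (nu `]a, b]%classic).
Proof.
move=> Gc GM a0 ab b1.
have sab : `]a, b]%classic `<=` I01 by apply: subset_itv; rewrite bnd_simp.
have gi := within01_integrable nu Gc (measurable_itv `[0, 1]) (@subset_refl _ I01).
rewrite (Rintegral_itv_split gi a0 ab b1) addrC addKr.
apply: normr_Rintegral_le => //; first exact: within01_integrable.
by move=> x /sab; rewrite /= in_itv /=; exact: GM.
Qed.

(** The remainders are controlled by the measure of the short interval between
    the two points, which tends to 0 in the absence of atoms. *)
Lemma C1_unit_potential nu G : non_atomic nu -> {within `[0, 1], continuous G} ->
  C1_unit (potential nu G) (fun x => \int[nu]_(t in `[0, x]) G t).
Proof.
move=> nua Gc; have [M M0 GM] := within01_bounded Gc.
have small x e : 0 < e -> exists2 d : R, 0 < d & forall a b, a <= x <= b ->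
    b - a < d -> M * fine (nu `]a, b]%classic) < e.
  move=> e0; have e1 : 0 < e / (M + 1) by rewrite divr_gt0//; lra.
  have [d d0 dP] := non_atomic_small x nua e1; exists d => // a b /andP[ax xb] bad.
  have : fine (nu `]a, b]%classic) <= e / (M + 1).
    rewrite -lee_fin fineK; last by rewrite fin_num_measure//; exact: measurable_itv.
    apply: le_trans dP; apply: le_measure; rewrite ?inE; [exact: measurable_itv|exact: measurable_itv|].
    by apply: subset_itv; rewrite bnd_simp; lra.
  rewrite ler_pdivlMr; last lra.
  have : 0 <= fine (nu `]a, b]%classic) by rewrite fine_ge0.
  rewrite le_eqVlt => /predU1P[<-|n0 h]; first by rewrite mulr0.
  by apply: lt_le_trans h; rewrite mulrC ltr_pM2l//; lra.
split; last first.
  apply/within01_continuousP => x /andP[x0 x1] e e0.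
  have [d d0 dP] := small x e e0; exists d => // y /andP[y0 y1] yx.
  have [xy|/ltW xy] := leP x y.
    rewrite (le_lt_trans (Rintegral_increment _ Gc GM x0 xy y1))//; apply: dP.
      by rewrite lexx.
    by move: yx; rewrite ltr_norml => /andP[].
  rewrite distrC (le_lt_trans (Rintegral_increment _ Gc GM y0 xy x1))//; apply: dP.
    by rewrite lexx andbT.
  by move: yx; rewrite ltr_norml => /andP[? ?]; lra.
move=> x; rewrite in_itv /= => /andP[x0 x1]; apply/diff_quotient01P => e e0.
have e20 : 0 < e / 2 by lra.
have [d d0 dP] := small x _ e20; exists d => // y /andP[y0 y1] yx yxd.
have yx0 : 0 < `|y - x| by rewrite normr_gt0 subr_eq0.
set K := potential nu G; set u := fun x => \int[nu]_(t in `[0, x]) G t.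
suff : `|K y - K x - (y - x) * u x| < e * `|y - x|.
  rewrite -ltr_pdivrMr// -normfV -normrM; congr (`|_| < _).
  by rewrite /u; field; rewrite subr_eq0.
have [xy|/ltW xy] := leP x y.
  rewrite (le_lt_trans (potential_increment _ Gc GM M0 x0 xy y1))//.
  rewrite (ger0_norm (x := y - x)) ?subr_ge0// in yx0 yxd *.
  rewrite mulrAC ltr_pM2r//; apply: lt_trans (dP _ _ _ yxd) _; last lra.
  by rewrite lexx.
have h1 := potential_increment nu Gc GM M0 y0 xy x1.
have h2 := Rintegral_increment nu Gc GM y0 xy x1.
rewrite (ler0_norm (x := y - x)) ?subr_le0// opprB in yx0 yxd *.
have h3 : M * fine (nu `]y, x]%classic) < e / 2.
  by apply: dP yxd; rewrite lexx andbT.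
(* to the left of [x], the expansion at [y] is used instead, and [u y] is then
   replaced by [u x] *)
have -> : K y - K x - (y - x) * u x =
  - (K x - K y - (x - y) * u y) + (x - y) * (u x - u y) by ring.
rewrite (le_lt_trans (ler_normD _ _))// normrN normrM (gtr0_norm yx0).
have h4 : (x - y) * `|u x - u y| <= (x - y) * (M * fine (nu `]y, x]%classic)).
  by rewrite ler_wpM2l// ltW.
have h5 : (x - y) * (M * fine (nu `]y, x]%classic)) < (x - y) * (e / 2).
  by rewrite ltr_pM2l.
have h6 : M * (x - y) * fine (nu `]y, x]%classic) = (x - y) * (M * fine (nu `]y, x]%classic)) by ring.
rewrite h6 in h1.
have h7 : e * (x - y) = (x - y) * (e / 2) + (x - y) * (e / 2) by field.
rewrite h7; apply: ltr_leD => //; last exact: le_trans h4 (ltW h5).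
exact: le_lt_trans h1 h5.
Qed.

Lemma potential0 nu G : {within `[0, 1], continuous G} -> potential nu G 0 = 0.
Proof.
move=> Gc; rewrite /potential (eq_Rintegral _ (g := fun=> 0)) ?Rintegral_cst ?mul0r//.
move=> t; rewrite inE /= in_itv /= => /andP[t0 t1].
have -> : t = 0 by lra.
by rewrite subrr mul0r.
Qed.

End potential.

(** * Weak convergence of measures and convergence of potentials *)

Section potential_approximation.
Context {R : realType}.
Local Notation I01 := `[(0 : R), (1 : R)]%classic.
Implicit Types (nu mu : probability R R) (G : R -> R) (a c e m x y M : R).

(** The Lipschitz constant does not depend on the measure. *)
Lemma potential_lipschitz nu G M : admissible nu -> {within `[0, 1], continuous G} ->
  (forall x, 0 <= x <= 1 -> `|G x| <= M) ->
  forall x y, 0 <= x <= 1 -> 0 <= y <= 1 ->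
    `|potential nu G x - potential nu G y| <= M * `|x - y|.
Proof.
move=> [nu1 _ _ _] Gc GM x y x01 y01; rewrite !potentialE//.
have mi z := within01_integrable nu (within01_max_integrand (x:=z) Gc)
  (measurable_itv `[0, 1]) (@subset_refl _ I01).
have mB := @integrableB _ _ _ _ _ (measurable_itv _) _ _ (mi x) (mi y).
rewrite -RintegralB//; apply: le_trans (normr_Rintegral_le (B := M * `|x - y|) _ mB _) _ => //.
  move=> t; rewrite /= in_itv /= => t01; rewrite -mulrBl normrM mulrC.
  apply: ler_pM => //; first exact: GM.
  have max0P z : Num.max (z - t) 0 = if t <= z then z - t else 0.
    by case: leP => tz; [rewrite max_l ?subr_ge0|rewrite max_r// subr_le0 ltW].
  rewrite !max0P; have [tx|xt] := leP t x; have [ty|yt] := leP t y.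
  - by rewrite opprB addrA subrK.
  - by rewrite subr0 !ger0_norm; lra.
  - by rewrite sub0r normrN ger0_norm ?ler0_norm; lra.
  - by rewrite subrr normr0.
by rewrite nu1 /= mulr1.
Qed.

Lemma potential_shift nu G m : admissible nu -> {within `[0, 1], continuous G} ->
  forall x, 0 <= x <= 1 ->
    `|potential nu (fun t => G t - m) x - potential nu G x| <= `|m|.
Proof.
move=> [nu1 _ _ _] Gc x x01.
have Hc : {within `[0, 1], continuous (fun t => G t - m)}.
  by move=> t; exact: (cvgB (Gc t) (cvg_cst m)).
rewrite !potentialE//.
have mi := within01_integrable nu (within01_max_integrand (x:=x) Gc)
  (measurable_itv `[0, 1]) (@subset_refl _ I01).
have mi' := within01_integrable nu (within01_max_integrand (x:=x) Hc)
  (measurable_itv `[0, 1]) (@subset_refl _ I01).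
have mB := @integrableB _ _ _ _ _ (measurable_itv _) _ _ mi' mi.
rewrite -RintegralB//; apply: le_trans (normr_Rintegral_le (B := `|m|) _ mB _) _ => //.
  move=> t; rewrite /= in_itv /= => t01; rewrite -mulrBr addrAC subrr sub0r normrM normrN.
  rewrite ler_piMl// ger0_norm; last by rewrite le_max lexx orbT.
  by rewrite ge_max ler01 andbT; lra.
by rewrite nu1 /= mulr1.
Qed.

Lemma potential_cvg (mu_ : nat -> probability R R) mu G :
  admissible mu -> (forall n, admissible (mu_ n)) -> weakly_converges mu_ mu ->
  {within `[0, 1], continuous G} -> forall e, 0 < e ->
  \forall n \near \oo, forall x, 0 <= x <= 1 ->
    `|potential (mu_ n) G x - potential mu G x| <= e.
Proof.
move=> muA mu_A weak Gc; have [M M0 GM] := within01_bounded Gc.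
apply: (@equi_lipschitz_cvg _ _ _ M) => //.
- by move=> n x y; exact: potential_lipschitz.
- by move=> x y; exact: potential_lipschitz.
move=> x x01; rewrite potentialE//.
under eq_fun do rewrite potentialE//.
exact: weak (within01_max_integrand Gc).
Qed.

(** Both sides have the same derivative and the same value at 0. *)
Lemma in_D2_potential mu (F F' G : R -> R) (g : LspaceType2 mu) : admissible mu ->
  in_D2 F F' g -> continuous_rep g G ->
  forall x, 0 <= x <= 1 -> F x = F 0 + F' 0 * x + potential mu G x.
Proof.
move=> [_ mua _ _] [FF' F'E] gG x /andP[x0 x1].
have Gc := gG.1.
have := C1_unit_lincomb (-1) FF' (C1_unit_potential mua Gc).
move=> /C1_unit_slope => /(_ 0 x (F' 0) (lexx _) x0 x1).
rewrite potential0//= => h; have : F x + -1 * potential mu G x - (F 0 + -1 * 0) = F' 0 * (x - 0).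
  apply: h => y /andP[y0 yx].
  have y01 : 0 <= y <= 1 by apply/andP; split; lra.
  rewrite F'E ?in_itv//= (Rintegral_continuous_rep gG) ?mulN1r ?addrK//.
  by apply: subset_itv; rewrite bnd_simp//; case/andP: y01.
lra.
Qed.

(** Conversely, an affine function plus a potential belongs to D2, and its
    density is the one of the potential. *)
Lemma KF_graph_potential b nu (H : R -> R) c a (F := fun x => c + a * x + potential nu H x)
    (F' := fun x => a + \int[nu]_(t in `[0, x]) H t) :
  admissible nu -> {within `[0, 1], continuous H} -> KF_boundary b F F' ->
  KF_graph b (L2class nu (F \_ I01)) (L2class nu (H \_ I01)).
Proof.
move=> nuA Hc bF; have [_ nua _ _] := nuA.
have FF' : C1_unit F F'.
  have := C1_unit_lincomb 1 (C1_unit_affine a c) (C1_unit_potential nua Hc).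
  rewrite (_ : (fun x => _) = F); last by apply/funext => x; rewrite /F mul1r.
  by rewrite (_ : (fun x => _) = F')//; apply/funext => x; rewrite /F' mul1r.
exists F, F'; split => //.
  by have [] := continuous_rep_L2class nu (C1_unit_continuous FF').
split => // x; rewrite in_itv /= => /andP[x0 x1].
rewrite (Rintegral_continuous_rep (continuous_rep_L2class nu Hc))//; last first.
  by apply: subset_itv; rewrite bnd_simp.
rewrite /F' [X in _ = a + X + _](_ : _ = 0) ?addr0//.
rewrite set_itv1 /Rintegral null_set_integral//.
- by apply: measurable_fun_set1.
- exact: non_atomic_set1.
Qed.

End potential_approximation.

(** * Approximation in the graphs of the operators *)

Theorem theorem5p6 (R : realType) (b : boundary)
    (mu : probability R R) (mu_ : nat -> probability R R)
    (hmu : admissible mu) (hmu_ : forall n, admissible (mu_ n))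
    (hsupp : forall n, supp mu `<=` supp (mu_ n))
    (hweak : weakly_converges mu_ mu)
    (f : LspaceType2 mu) (hf : KF_part_dom b mu f) :
  exists f_ : forall n, LspaceType2 (mu_ n),
    (forall n, KF_part_dom b (mu_ n) (f_ n)) /\
    (Cnorm (L2sub (embed (mu_ n) f) (f_ n)) +
     Cnorm (L2sub (embed (mu_ n) (KF b f)) (KF b (f_ n))))
      @[n --> \oo] --> (0 : R).
Proof.
have [fdom [g grep g01]] := hf.
have [F [F' [Ff FD2 Fb]]] := KF_graph_KF fdom.
have [Gg Glin] := gap_linear_repP hmu grep.
set G := gap_linear_rep (KF b f) in Gg Glin.
have Gc := Gg.1; have Fc := C1_unit_continuous FD2.1.
have [Lf Llin] := gap_linear_repP hmu (conj Fc Ff : continuous_rep f F).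
set L := gap_linear_rep f in Lf Llin.
have LF : forall x : R, 0 <= x <= 1 -> L x = F x.
  apply: (linear_on_gaps_ext hmu Lf.1 Llin Fc (in_D2_linear_on_gaps FD2)).
  exact: (represents_supp_eq hmu Lf.1 Fc Lf.2 Ff).
have s0 : supp mu 0 by case: hmu.
have s1 : supp mu 1 by case: hmu.
have Gb : b = Dirichlet -> G 0 = 0 /\ G 1 = 0.
  move=> bD; have Ggs := represents_supp_eq hmu Gc grep.1 Gg.2 grep.2.
  by rewrite !Ggs//; move: g01; rewrite bD.
have FE := in_D2_potential hmu FD2 Gg.
(* the corrections of the density and of the slope that restore the boundary
   conditions for [mu_ n] *)
pose m n : R := if b is Neumann then \int[mu_ n]_(t in `[0, 1]) G t else 0.
pose H n (t : R) : R := G t - m n.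
pose a n : R := if b is Neumann then 0 else - potential (mu_ n) (H n) 1.
pose F_ n (x : R) := F 0 + a n * x + potential (mu_ n) (H n) x.
pose f_ n := L2class (mu_ n) (F_ n \_ `[0, 1]%classic).
pose g_ n := L2class (mu_ n) (H n \_ `[0, 1]%classic).
have Hc n : {within `[0, 1], continuous (H n)}.
  by move=> t; exact: (cvgB (Gc t) (cvg_cst (m n))).
have bND : b = Neumann \/ b = Dirichlet by case: (b); [left|right].
have graph n : KF_graph b (f_ n) (g_ n).
  apply: KF_graph_potential => //; have [mu1 nua _ _] := hmu_ n.
  have [bN|bD] := bND.
    rewrite /a /H /m bN; split; rewrite add0r.
      rewrite set_itv1 /Rintegral null_set_integral//; first exact: measurable_fun_set1.
      exact: non_atomic_set1.
    have c1 r : \int[mu_ n]_(_ in `[0, 1]) r = r.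
      by rewrite Rintegral_cst// -[RHS]mulr1; congr (_ * _); exact: (congr1 fine mu1).
    rewrite RintegralB//; first by rewrite c1 subrr.
    - exact: within01_integrable.
    - exact: finite_measure_integrable_cst.
  move: Fb; rewrite /a bD => -[F0 _].
  by split; rewrite F0 ?mulr0 ?mulr1 add0r ?add0r ?addNr// potential0.
exists f_; split=> [n|].
  split; first by exists (g_ n).
  rewrite (KF_graph_eq (hmu_ n) (graph n)); exists (H n); first exact: continuous_rep_L2class.
  have [bN|bD] := bND; first by rewrite bN.
  by have [G0 G1] := Gb bD; rewrite bD /H /m bD G0 G1 subr0.
(* in the Neumann case, the integral of [G] with respect to [mu] is F' 1 - F' 0 *)
have m0 : m n @[n --> \oo] --> 0.
  have [bN|bD] := bND; last by rewrite /m bD; exact: cvg_cst.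
  suff <- : \int[mu]_(t in `[0, 1]) G t = 0 by rewrite /m bN; exact: hweak.
  move: Fb; rewrite bN => -[F0 F1].
  rewrite -(Rintegral_continuous_rep Gg)//.
  by have := FD2.2 1; rewrite F0 F1 add0r in_itv /= ler01 lexx => /(_ isT).
(* the two norms are at most 2 (|m n| + e / 6) and |m n|, and |m n| < e / 6 *)
apply/cvgrPdist_lt => e e0; have e6 : 0 < e / 6 by lra.
have /cvgrPdist_lt /(_ _ e6) mn := m0.
have Kn := potential_cvg hmu hmu_ hweak Gc e6.
move: mn Kn; apply: filterS2 => n; rewrite sub0r normrN => mn Kn.
have D (x : R) : 0 <= x <= 1 ->
    `|potential (mu_ n) (H n) x - potential mu G x| <= `|m n| + e / 6.
  move=> x01; have h1 := potential_shift (m n) (hmu_ n) Gc x01.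
  have h2 := Kn x x01.
  have -> : potential (mu_ n) (H n) x - potential mu G x =
    (potential (mu_ n) (H n) x - potential (mu_ n) G x) +
    (potential (mu_ n) G x - potential mu G x) by ring.
  by rewrite (le_trans (ler_normD _ _))// lerD.
(* in the Dirichlet case, the slopes are the opposites of the potentials at 1 *)
have aE : `|a n - F' 0| <= `|m n| + e / 6.
  have [bN|bD] := bND.
    by move: Fb; rewrite /a bN => -[-> _]; rewrite subrr normr0 addr_ge0// ltW.
  have i01 : 0 <= (1 : R) <= 1 by rewrite ler01 lexx.
  move: Fb; rewrite /a bD => -[F0 F1]; have := FE _ i01; rewrite F1 F0 => E1.
  rewrite (_ : _ - _ = - (potential (mu_ n) (H n) 1 - potential mu G 1)); last by lra.
  by rewrite normrN; exact: D.
have FF_ (x : R) : 0 <= x <= 1 -> `|L x - F_ n x| <= 2 * (`|m n| + e / 6).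
  move=> x01; rewrite LF// FE// /F_ distrC.
  have h := D x x01; have /andP[x0 x1] := x01.
  rewrite (_ : _ - _ = (a n - F' 0) * x +
    (potential (mu_ n) (H n) x - potential mu G x)); last by ring.
  rewrite (le_trans (ler_normD _ _))// normrM (ger0_norm x0).
  have : `|a n - F' 0| * x <= `|a n - F' 0| by rewrite ler_piMr.
  lra.
have GH (x : R) : 0 <= x <= 1 -> `|G x - H n x| <= `|m n|.
  by move=> _; rewrite /H opprB addrC subrK.
have embL : continuous_rep (embed (mu_ n) f) L by exact: continuous_rep_L2class Lf.1.
have embG : continuous_rep (embed (mu_ n) (KF b f)) G by exact: continuous_rep_L2class Gc.
have fF : continuous_rep (f_ n) (F_ n).
  have [_ nua _ _] := hmu_ n; apply: continuous_rep_L2class.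
  have := C1_unit_lincomb 1 (C1_unit_affine (a n) (F 0)) (C1_unit_potential nua (Hc n)).
  move/C1_unit_continuous; rewrite (_ : (fun x => _) = F_ n)//.
  by apply/funext => x; rewrite /F_ mul1r.
rewrite (KF_graph_eq (hmu_ n) (graph n)).
have /andP[c1 c1'] := Cnorm_le (hmu_ n) (continuous_rep_L2sub embL fF) FF_.
have gH : continuous_rep (g_ n) (H n) by exact: continuous_rep_L2class.
have /andP[c2 c2'] := Cnorm_le (hmu_ n) (continuous_rep_L2sub embG gH) GH.
move: (Cnorm _) (Cnorm _) c1 c1' c2 c2' => A B A0 A1 B0 B1.
rewrite sub0r normrN ger0_norm ?addr_ge0//.
by move: (`|m n|) mn A1 B1 => r mn A1 B1; lra.
Qed.
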